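(* If $A$ is a subfit lattice, then its MacNeille completion $MA$ is a frame.
   Context: A distributive lattice $A$ with top element $1$ (not assumed to have a least element) is subfit (conjunctive) if whenever $a\not\le b$ in $A$ there is $c\in A$ such that $a\vee c=1$ and $b\vee c\ne 1$. $MA$ is the MacNeille completion of $A$: the complete lattice, under inclusion, of normal ideals of $A$, where a subset $E\subseteq A$ is a normal ideal if it equals the set of lower bounds of the set of upper bounds of $E$. *)

(* Defs.v *)
From HB Require Import structures.
From mathcomp Require Import all_boot all_order.
From mathcomp Require Import boolp classical_sets.

Set Implicit Arguments.
Unset Strict Implicit.
Unset Printing Implicit Defensive.

Import Order.TTheory.
Local Open Scope classical_set_scope.
Local Open Scope order_scope.

(* No least element is required: [tDistrLatticeType] only provides a top. *)
Definition subfit {d : Order.disp_t} (A : tDistrLatticeType d) : Prop :=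
  forall a b : A, ~ (a <= b) ->
    exists c : A, (a `|` c)%O = \top /\ (b `|` c)%O <> \top.

Definition complete_lattice {d : Order.disp_t} (L : latticeType d) : Prop :=
  forall S : set L, exists m : L, isLub S m.

Definition frame {d : Order.disp_t} (L : latticeType d) : Prop :=
  complete_lattice L /\
  forall (x : L) (S : set L) (m : L),
    isLub S m -> isLub [set (x `&` y)%O | y in S] (x `&` m)%O.

Definition normal_ideal {d : Order.disp_t} {A : porderType d} (E : set A) :
  Prop := E = lbound (ubound E).

Record macneille {d : Order.disp_t} (A : porderType d) : Type := MacNeille {
  macneille_val :> set A;
  macneille_valP : `[< normal_ideal macneille_val >]
}.

Fact macneille_display : Order.disp_t -> Order.disp_t. Proof. by []. Qed.

Section MacNeille.
Context {d : Order.disp_t} {A : porderType d}.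
Implicit Types (E F G : macneille A) (B C : set A).

HB.instance Definition _ := [isSub for @macneille_val d A].
HB.instance Definition _ := [Choice of macneille A by <:].
(* Inclusion, inherited from the subset order on [set A]. *)
HB.instance Definition _ := [SubChoice_isSubPOrder of macneille A by <:
  with macneille_display d].

Lemma leMacNeille E F : E <= F <-> (E : set A) `<=` F.
Proof. by rewrite -Order.le_val subsetEset. Qed.

Lemma macneilleE E : lbound (ubound E) = E :> set A.
Proof. by have /asboolP <- := macneille_valP E. Qed.

Lemma sub_lub B : B `<=` lbound (ubound B).
Proof. by move=> x Bx y; exact. Qed.

Lemma lub_mono B C : B `<=` C -> lbound (ubound B) `<=` lbound (ubound C).
Proof. by move=> BC x xB y yC; apply: xB => z /BC; exact: yC. Qed.

Lemma normal_lub B : normal_ideal (lbound (ubound B)).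
Proof.
apply/seteqP; split; first exact: sub_lub.
by move=> x xB y yB; apply: xB => z; exact.
Qed.

Lemma normalI E F : normal_ideal ((E : set A) `&` F)%classic.
Proof.
apply/seteqP; split; first exact: sub_lub.
by move=> x xEF; rewrite -(macneilleE E) -(macneilleE F); split;
  apply: lub_mono xEF => y [].
Qed.

Definition macneille_meet E F : macneille A := MacNeille (asboolT (normalI E F)).

Definition macneille_closure B : macneille A :=
  MacNeille (asboolT (normal_lub B)).

Definition macneille_join E F : macneille A :=
  macneille_closure ((E : set A) `|` F)%classic.

Lemma lexMacNeille G E F : (G <= macneille_meet E F) = (G <= E) && (G <= F).
Proof.
apply/idP/andP => [/leMacNeille GEF|[/leMacNeille GE /leMacNeille GF]].
  by split; apply/leMacNeille => x /GEF [].
by apply/leMacNeille => x Gx; split; [exact: GE|exact: GF].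
Qed.

Lemma leUMacNeille E F G : (macneille_join E F <= G) = (E <= G) && (F <= G).
Proof.
apply/idP/andP => [/leMacNeille EFG|[/leMacNeille EG /leMacNeille FG]].
  by split; apply/leMacNeille => x ?; apply/EFG/sub_lub; [left|right].
apply/leMacNeille; rewrite -(macneilleE G); apply: lub_mono => x [].
  exact: EG.
exact: FG.
Qed.

HB.instance Definition _ := Order.POrder_MeetJoin_isLattice.Build
  (macneille_display d) (macneille A) lexMacNeille leUMacNeille.

End MacNeille.

(* Main.v *)
Require Import Defs.
From mathcomp Require Import all_boot all_order.
From mathcomp Require Import boolp classical_sets.

Set Implicit Arguments.
Unset Strict Implicit.
Unset Printing Implicit Defensive.

Import Order.TTheory.
Local Open Scope classical_set_scope.
Local Open Scope order_scope.

(** Suprema in the MacNeille completion are normal closures of unions, so it is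
    always complete; the content is distributivity.  Let [m] be the supremum of
    a family [S] of normal ideals, and let [n] be a normal ideal containing
    every [x `&` y], [y] in [S].  Take [a] in [x `&` m] and suppose that [a]
    is not in [n].  By normality of [n], [a] fails to lie below some upper bound
    [u] of [n], and subfitness yields [c] with [a `|` c = \top] and
    [u `|` c <> \top].  For [e] in a member of [S], the element [a `&` e]
    belongs to [n], hence lies below [u]; since [a `|` c = \top], distributivity
    turns this into [e <= u `|` c] ([le_join_of_meet]).  The whole family is
    therefore below the principal ideal of [u `|` c], and so is its supremum
    [m].  In particular [a <= u `|` c], whence [u `|` c] is above
    [a `|` c = \top], a contradiction. *)

(** Joining both sides of [a `&` e <= u] with a [c] that complements [a] from
    above makes [a] disappear. *)
Lemma le_join_of_meet {d : Order.disp_t} (A : tDistrLatticeType d)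
  (a c e u : A) : a `|` c = \top -> a `&` e <= u -> e <= u `|` c.
Proof.
move=> ac aeu; apply: (@le_trans _ _ ((a `&` e) `|` c)); last exact: leU2.
by rewrite joinIl ac meet1x leUl.
Qed.

Lemma macneille_down {d : Order.disp_t} {A : porderType d}
  (E : macneille A) (x y : A) : x <= y -> (E : set A) y -> (E : set A) x.
Proof.
rewrite -(macneilleE E) => xy Ey u Eu; apply: le_trans xy _; exact: Ey.
Qed.

Lemma macneille_closure_le {d : Order.disp_t} {A : porderType d}
  (B : set A) (E : macneille A) :
  (macneille_closure B <= E) <-> B `<=` (E : set A).
Proof.
split=> [/leMacNeille BE x Bx|BE]; first exact/BE/sub_lub.
by apply/leMacNeille; rewrite -(macneilleE E); exact: lub_mono.
Qed.

(** The normal closure of a point is its principal down-set, through which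
    bounds in [A] are transported to bounds in the completion. *)
Lemma macneille_closure1 {d : Order.disp_t} {A : porderType d} (v x : A) :
  (macneille_closure [set v] : set A) x <-> x <= v.
Proof.
split=> [xv|xv y yv]; first by apply: xv => _ ->.
by apply: le_trans xv _; exact: yv.
Qed.

Lemma macneille_complete {d : Order.disp_t} (A : porderType d) :
  complete_lattice (macneille A).
Proof.
move=> S; exists (macneille_closure (\bigcup_(E in S) (E : set A))); split.
  move=> E SE; apply/leMacNeille => x Ex.
  by apply: sub_lub; exists E.
move=> F SF; apply/macneille_closure_le => x [E SE Ex].
by have /leMacNeille := SF _ SE; exact.
Qed.

Theorem proposition3p17 (d : Order.disp_t) (A : tDistrLatticeType d)
  (hA : subfit A) : frame (macneille A).
Proof.
split; first exact: macneille_complete.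
move=> x S m [mS m_least]; split.
  by move=> _ [y Sy <-]; apply: leI2 => //; exact: mS.
move=> n nS; apply/leMacNeille => a [xa ma].
rewrite -(macneilleE n) => u nu.
apply: contrapT => /hA [c [ac]]; apply.
have e_le (y : macneille A) (e : A) : S y -> (y : set A) e -> e <= u `|` c.
  move=> Sy ye; apply: (le_join_of_meet ac); apply: nu.
  have /leMacNeille : (x `&` y)%O <= n by apply: nS; exists y.
  by apply; split; [exact: macneille_down (leIl _ _) xa
                   |exact: macneille_down (leIr _ _) ye].
have /leMacNeille m_le : m <= macneille_closure [set u `|` c].
  apply: m_least => y Sy; apply/leMacNeille => e ye.
  by apply/macneille_closure1; exact: e_le ye.
have /macneille_closure1 a_le := m_le _ ma.
by apply: le_anti; rewrite lex1 -ac leUx a_le leUr.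
Qed.
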